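(* Let $d\ge 1$, $L>0$, and let $c_0>0$ be a constant. There is a constant $c>0$ depending only on $c_0$ such that for all integers $M\ge2$ and $n\ge1$ with $M\le c_0n$ there exist probability densities $p_1,\dots,p_M\in L_2(\mathbb{R}^d)$ such that $$\inf_{T_n}\sup_{p\in\mathcal{P}_0}\Big[R_n(T_n,p)-\inf_{\lambda\in\mathbb{R}^M}\|\mathsf{p}_\lambda-p\|^2\Big]\ge \frac{cLM}{n},$$ where $\inf_{T_n}$ denotes the infimum over all estimators $T_n$ of $p$ based on $X_1,\dots,X_n$.
   Context: $X_1,\dots,X_n$ are i.i.d. random vectors in $\mathbb{R}^d$ with density $p$. $\|\cdot\|$ is the $L_2(\mathbb{R}^d)$ norm and $\|\cdot\|_\infty$ the $L_\infty(\mathbb{R}^d)$ norm. $\mathcal{P}_0$ is the class of all probability densities $p$ on $\mathbb{R}^d$ with $\|p\|_\infty\le L$. For $\lambda\in\mathbb{R}^M$, $\mathsf{p}_\lambda=\sum_{j=1}^M\lambda_jp_j$. For an estimator $T_n$ (a measurable function of the sample with values in functions on $\mathbb{R}^d$), $R_n(T_n,p)=E_p^n\|T_n-p\|^2$, where $E_p^n$ is the expectation with respect to the distribution of $(X_1,\dots,X_n)$ when the density is $p$. *)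

(* Defs.v *)
From HB Require Import structures.
From mathcomp Require Import all_boot all_order all_algebra.
From mathcomp Require Import all_classical all_reals all_analysis.
From mathcomp Require Import measurable_realfun ess_sup_inf.

Set Implicit Arguments.
Unset Strict Implicit.
Unset Printing Implicit Defensive.

Import Order.TTheory GRing.Theory Num.Theory.
Import numFieldNormedType.Exports.

Local Open Scope classical_set_scope.
Local Open Scope ring_scope.

Section cons_measure.
Context d (T : measurableType d) (R : realType) (n : nat).

Definition cons_pair (z : T * n.-tuple T) : n.+1.-tuple T :=
  [tuple of z.1 :: z.2].

Lemma measurable_cons_pair : measurable_fun [set: T * n.-tuple T] cons_pair.
Proof. exact: measurable_cons. Qed.

Definition cons_measure (mu : {sigma_finite_measure set T -> \bar R})
    (nu : {sigma_finite_measure set (n.-tuple T) -> \bar R}) :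
    set (n.+1.-tuple T) -> \bar R :=
  pushforward (mu \x nu)%E cons_pair.

Variable mu : {sigma_finite_measure set T -> \bar R}.
Variable nu : {sigma_finite_measure set (n.-tuple T) -> \bar R}.

Let cons_measure0 : cons_measure mu nu set0 = 0%E.
Proof. by rewrite /cons_measure measure0//; exact: measurable_cons_pair. Qed.

Let cons_measure_ge0 A : (0 <= cons_measure mu nu A)%E.
Proof. by rewrite /cons_measure /pushforward measure_ge0. Qed.

Let cons_measure_sigma_additive : semi_sigma_additive (cons_measure mu nu).
Proof. by apply: measure_semi_sigma_additive; exact: measurable_cons_pair. Qed.

HB.instance Definition _ := isMeasure.Build _ _ _ (cons_measure mu nu)
  cons_measure0 cons_measure_ge0 cons_measure_sigma_additive.

Let cons_measure_sigma_finite : sigma_finite setT (cons_measure mu nu).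
Proof.
have /sigma_finiteP[F [TF ndF Foo]] := sigma_finiteT mu.
have /sigma_finiteP[G [TG ndG Goo]] := sigma_finiteT nu.
pose g (t : n.+1.-tuple T) := (thead t, [tuple of behead t]).
have gK : cancel cons_pair g.
  by move=> [x t]; rewrite /g /cons_pair/= theadE; congr pair; exact: val_inj.
have mg : measurable_fun setT g.
  apply: measurable_fun_pair; first exact: measurable_tnth.
  exact: measurable_behead.
exists (fun i => g @^-1` (F i `*` G i)).
  rewrite -preimage_bigcup (_ : \bigcup_i _ = setT) ?preimage_setT//.
  rewrite -subTset => -[x t] _.
  have [i _ Fix] : (\bigcup_i F i) x by rewrite -TF.
  have [j _ Gjt] : (\bigcup_i G i) t by rewrite -TG.
  exists (maxn i j) => //; split => /=.
    by move: x Fix; exact/subsetPset/ndF/leq_maxl.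
  by move: t Gjt; exact/subsetPset/ndG/leq_maxr.
move=> i; have [mFi Fioo] := Foo i; have [mGi Gioo] := Goo i; split.
  by rewrite -[X in measurable X]setTI; apply: mg => //; exact: measurableX.
rewrite /cons_measure /pushforward -comp_preimage (_ : _ \o _ = id).
  by rewrite preimage_id product_measure1E// lte_mul_pinfty// ge0_fin_numE.
by apply/funext => z /=; rewrite gK.
Qed.

HB.instance Definition _ := Measure_isSigmaFinite.Build _ _ _
  (cons_measure mu nu) cons_measure_sigma_finite.

End cons_measure.

(* The n-fold product measure, on the product sigma-algebra of n.-tuple T;
   power_measure_box characterizes it. *)
Fixpoint power_measure d (T : measurableType d) (R : realType)
    (mu : {sigma_finite_measure set T -> \bar R}) (n : nat) :
    {sigma_finite_measure set (n.-tuple T) -> \bar R} :=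
  if n is m.+1 then cons_measure mu (power_measure mu m)
  else dirac ([tuple] : 0.-tuple T).

Lemma measurable_box d (T : measurableType d) (n : nat) (A : 'I_n -> set T) :
  (forall i, measurable (A i)) ->
  measurable [set t : n.-tuple T | forall i, A i (tnth t i)].
Proof.
move=> mA; rewrite (_ : mkset _ =
    \bigcap_(i in [set: 'I_n]) ((fun t : n.-tuple T => tnth t i) @^-1` A i)).
  apply: fin_bigcap_measurable => // i _.
  by rewrite -[X in measurable X]setTI; exact: measurable_tnth.
by apply/seteqP; split=> t /= At i; [move=> _|]; exact: At.
Qed.

Lemma power_measure_box d (T : measurableType d) (R : realType)
    (mu : {sigma_finite_measure set T -> \bar R}) (n : nat)
    (A : 'I_n -> set T) : (forall i, measurable (A i)) ->
  power_measure mu n [set t | forall i, A i (tnth t i)] =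
  (\prod_(i < n) mu (A i))%E.
Proof.
elim: n A => [A mA|n ih A mA] /=.
  rewrite big_ord0 diracE mem_set//=.
  by case.
rewrite /cons_measure /pushforward (_ : _ @^-1` _ =
    A ord0 `*` [set t : n.-tuple T | forall i, A (lift ord0 i) (tnth t i)]).
  rewrite product_measure1E//=; last first.
    by apply: (@measurable_box _ _ _ (fun i => A (lift ord0 i))) => i.
  by rewrite (ih (fun i => A (lift ord0 i))) ?big_ord_recl.
apply/seteqP; split=> -[x t] /=.
  move=> Axt; split; first exact: (Axt ord0).
  by move=> i; have := Axt (lift ord0 i); rewrite tnthS.
move=> [Ax At] i.
by have [j ->|->//] := unliftP ord0 i; rewrite tnthS.
Qed.

Section euclidean.
Context (R : realType) (d : nat).

(* R^d with its Borel sigma-algebra *)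
Definition Rd := d.-tuple (measurableTypeR R).

Definition lebesgue_Rd : {sigma_finite_measure set Rd -> \bar R} :=
  power_measure (@lebesgue_measure R) d.

Definition L2norm (f : Rd -> R) : \bar R := 'N[lebesgue_Rd]_2%:E[EFin \o f]%E.

Definition Linftynorm (f : Rd -> R) : \bar R :=
  'N[lebesgue_Rd]_+oo[EFin \o f]%E.

Record density := Density {
  pdf :> Rd -> R;
  measurable_pdf : measurable_fun [set: Rd] pdf;
  pdf_ge0 : forall x, 0 <= pdf x;
  integral_pdf : (\int[lebesgue_Rd]_x (pdf x)%:E = 1)%E }.


Section law.
Variable p : density.

(* the distribution on R^d of a random vector with density p *)
Definition law (A : set Rd) : \bar R := (\int[lebesgue_Rd]_(x in A) (p x)%:E)%E.

Let law0 : law set0 = 0%E.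
Proof. by rewrite /law integral_set0. Qed.

Let law_ge0 A : (0 <= law A)%E.
Proof. by apply: integral_ge0 => x _; rewrite lee_fin pdf_ge0. Qed.

Let law_sigma_additive : semi_sigma_additive law.
Proof.
move=> /= F mF tF mUF; rewrite /law; apply: cvg_toP.
  apply: ereal_nondecreasing_is_cvgn => m n mn.
  apply: lee_sum_nneg_natr => // k _ _; exact: law_ge0.
rewrite ge0_integral_bigcup//=.
- apply/measurable_EFinP; apply: (@measurable_funS _ _ _ _ [set: Rd]) => //.
  exact: measurable_pdf.
- by move=> x _; rewrite lee_fin pdf_ge0.
Qed.

HB.instance Definition _ := isMeasure.Build _ _ _ law
  law0 law_ge0 law_sigma_additive.

Let law_setT : law [set: Rd] = 1%E.
Proof. exact: integral_pdf. Qed.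

HB.instance Definition _ := @Measure_isProbability.Build _ _ R law law_setT.

End law.

(* densities bounded almost everywhere by L: the class P_0 *)
Definition bounded_densities (L : R) : set density :=
  [set p | (Linftynorm p <= L%:E)%E].

Definition mixture (M : nat) (q : 'I_M -> density) (lambda : 'rV[R]_M)
  (x : Rd) : R := \sum_(j < M) lambda 0 j * q j x.

(* T x is the estimated function when the sample is x; measurability is joint
   in the sample and in the point of R^d, and T x need not be in L_2: its
   L2norm, hence the risk of T, may be +oo. *)
Definition estimator (n : nat) : set (n.-tuple Rd -> Rd -> R) :=
  [set T | measurable_fun [set: n.-tuple Rd * Rd] (fun z => T z.1 z.2)].

Definition risk (n : nat) (T : n.-tuple Rd -> Rd -> R) (p : density) : \bar R :=
  (\int[power_measure (law p) n]_x (L2norm (T x \- p)%R ^+ 2))%E.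

Definition oracle_risk (M : nat) (q : 'I_M -> density) (p : density) : \bar R :=
  ereal_inf [set (L2norm (mixture q lambda \- p)%R ^+ 2)%E
            | lambda in [set: 'rV[R]_M]].

End euclidean.

Arguments bounded_densities {R} d L.
Arguments estimator : clear implicits.

(* Main.v *)
(* Assouad's method.  Put m = M - 1 and choose 2m disjoint cells H (k, b), with
   k < m and b : bool, each of volume 1 / (L m).  For a vector a in [-1, 1]^m
   let f_a be the density equal to L/2 (1 + a_k) on H (k, true) and to
   L/2 (1 - a_k) on H (k, false); it is bounded by L and affine in a, so the
   M densities given by a = 0 and the m unit vectors span all the f_a, and the
   oracle risk of f_a vanishes.  Let a run through {-eps, eps}^m with eps^2 of
   order M / n.  Flipping one coordinate keeps the affinity of the n-fold
   product laws at least 1/2 and changes the density by L eps on two cells, so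
   every coordinate contributes at least L eps^2 / (32 m) to the average risk of
   any estimator. *)
Require Import Defs.
From mathcomp Require Import all_boot all_order all_algebra.
From mathcomp Require Import all_classical all_reals all_analysis.
From mathcomp Require Import measurable_realfun ess_sup_inf ring lra.

Set Implicit Arguments.
Unset Strict Implicit.
Unset Printing Implicit Defensive.

Import Order.TTheory GRing.Theory Num.Theory.
Local Open Scope classical_set_scope.
Local Open Scope ring_scope.

(** * Integrals against product laws, rewritten over the product Lebesgue measure *)

Lemma ge0_integral_power_measureS d (T : measurableType d) (R : realType)
    (mu : {sigma_finite_measure set T -> \bar R}) (n : nat)
    (f : n.+1.-tuple T -> \bar R) :
  measurable_fun setT f -> (forall t, 0 <= f t)%E ->
  (\int[power_measure mu n.+1]_t f t =
   \int[mu]_x \int[power_measure mu n]_t f (cons_pair (x, t)))%E.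
Proof.
move=> mf f0.
rewrite /= /cons_measure ge0_integral_pushforward//; last exact: measurable_cons_pair.
rewrite preimage_setT fubini_tonelli1 //.
  apply: measurableT_comp => //; exact: measurable_cons_pair.
by move=> x /=.
Qed.

(** [law p] is dominated by Lebesgue measure. Its Radon-Nikodym derivative and [p] have the same
    integral over every measurable set, so they agree almost everywhere. *)
Lemma ge0_integral_law (R : realType) (d : nat) (p : density R d)
    (f : Rd R d -> \bar R) :
  measurable_fun setT f -> (forall x, 0 <= f x)%E ->
  (\int[law p]_x f x = \int[lebesgue_Rd R d]_x (f x * (p x)%:E))%E.
Proof.
move=> mf f0; set lam := lebesgue_Rd R d.
have mp : measurable_fun setT (fun x => (p x)%:E).
  by apply/measurable_EFinP; exact: measurable_pdf.
have p_lam : law p `<< lam.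
  apply/(null_content_dominatesP (law p) lam) => A mA A0.
  by rewrite /law/= null_set_integral//; exact: measurable_funTS.
rewrite -(Radon_Nikodym_SigmaFinite.change_of_variables p_lam)//.
have mg := measurable_int _ (Radon_Nikodym_SigmaFinite.f_integrable p_lam).
apply: ge0_ae_eq_integral => //.
- exact: emeasurable_funM.
- exact: emeasurable_funM.
- by move=> x _; rewrite mule_ge0// Radon_Nikodym_SigmaFinite.f_ge0.
- by move=> x _; rewrite mule_ge0// lee_fin pdf_ge0.
- apply: ae_eqe_mul2l; apply: integral_ae_eq => //.
    exact: Radon_Nikodym_SigmaFinite.f_integrable.
  by move=> E _ mE; rewrite -Radon_Nikodym_SigmaFinite.f_integral.
Qed.

Lemma prod_tnth_cons d (T : measurableType d) (R : realType) (n : nat)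
    (h : T -> R) (x : T) (t : n.-tuple T) :
  \prod_(i < n.+1) h (tnth (cons_pair (x, t)) i) = h x * \prod_(i < n) h (tnth t i).
Proof.
rewrite big_ord_recl; congr (_ * _).
by apply: eq_bigr => i _; rewrite tnthS.
Qed.

Lemma measurable_prod_tnth d (T : measurableType d) (R : realType) (n : nat) (h : T -> R) :
  measurable_fun setT h ->
  measurable_fun setT (fun t : n.-tuple T => (\prod_(i < n) h (tnth t i))%:E).
Proof.
move=> mh; apply/measurable_EFinP; apply: measurable_prod => i _.
by apply: measurableT_comp => //; exact: measurable_tnth.
Qed.

(** This brings expectations under different densities to one common measure, where the integrands
    can be compared pointwise. The induction peels off the first observation by Tonelli's
    theorem. *)
Lemma ge0_integral_power_law (R : realType) (d : nat) (p : density R d) (n : nat)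
    (f : n.-tuple (Rd R d) -> \bar R) :
  measurable_fun setT f -> (forall t, 0 <= f t)%E ->
  (\int[power_measure (law p) n]_t f t =
   \int[power_measure (lebesgue_Rd R d) n]_t
     (f t * (\prod_(i < n) p (tnth t i))%:E))%E.
Proof.
have prod_ge0 k (t : k.-tuple (Rd R d)) : (0 <= (\prod_(i < k) p (tnth t i))%:E)%E.
  by rewrite lee_fin prodr_ge0// => i _; exact: pdf_ge0.
have mp := @measurable_pdf _ _ p.
elim: n f => [|n IHn] f mf f0.
  rewrite /= !integral_dirac//.
    by rewrite big_ord0 mule1.
  by apply: emeasurable_funM => //; exact: measurable_prod_tnth.
rewrite !ge0_integral_power_measureS//; last first.
- by move=> t; rewrite mule_ge0.
- by apply: emeasurable_funM => //; exact: measurable_prod_tnth.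
have mfc := measurableT_comp mf (measurable_cons_pair (T := Rd R d) (n := n)).
have mfx x : measurable_fun setT (fun t => f (cons_pair (x, t))).
  exact: (measurableT_comp mfc (pair1_measurable x)).
under eq_integral do rewrite IHn//.
rewrite ge0_integral_law; last first.
- by move=> x; apply: integral_ge0 => t _; rewrite mule_ge0.
- apply: (@measurable_fun_fubini_tonelli_F _ _ _ _ _ (power_measure (lebesgue_Rd R d) n)
    (fun z => (f (cons_pair z) * (\prod_(i < n) p (tnth z.2 i))%:E)%E)).
  + apply: emeasurable_funM => //.
    exact: (measurableT_comp (measurable_prod_tnth mp) measurable_snd).
  + by move=> z; rewrite mule_ge0.
apply: eq_integral => x _; rewrite -ge0_integralZr//.
- by apply: eq_integral => t _; rewrite prod_tnth_cons EFinM -muleA [X in (_ * X)%E]muleC.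
- by apply: emeasurable_funM => //; exact: measurable_prod_tnth.
- by move=> t _; rewrite mule_ge0.
- by rewrite lee_fin pdf_ge0.
Qed.

(** Two uses: a product of densities has mass 1, and the affinity of two product laws is a power of
    the affinity of one factor. *)
Lemma ge0_integral_power_prod d (T : measurableType d) (R : realType)
    (mu : {sigma_finite_measure set T -> \bar R}) (n : nat) (h : T -> R) :
  measurable_fun setT h -> (forall x, 0 <= h x) ->
  (\int[power_measure mu n]_t (\prod_(i < n) h (tnth t i))%:E =
   (\int[mu]_x (h x)%:E) ^+ n)%E.
Proof.
move=> mh h0.
have prod_ge0 k (t : k.-tuple T) : (0 <= (\prod_(i < k) h (tnth t i))%:E)%E.
  by rewrite lee_fin prodr_ge0.
elim: n => [|n IHn].
  rewrite /= integral_dirac//; first by rewrite big_ord0 mule1 probability_setT.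
  exact: measurable_prod_tnth.
rewrite ge0_integral_power_measureS//; last exact: measurable_prod_tnth.
under eq_integral => x _.
  under eq_integral do rewrite prod_tnth_cons EFinM.
  rewrite ge0_integralZl// ?lee_fin//; last exact: measurable_prod_tnth.
  rewrite IHn; over.
rewrite ge0_integralZr//; first by rewrite expeS.
- exact/measurable_EFinP.
- by move=> x _; rewrite lee_fin.
- by rewrite expe_ge0// integral_ge0// => x _; rewrite lee_fin.
Qed.

(** * The squared norm as an integral, and the two-point bound *)

Lemma L2norm_sqr (R : realType) (d : nat) (f : Rd R d -> R) :
  (L2norm f ^+ 2 = \int[lebesgue_Rd R d]_x (f x ^+ 2)%:E)%E.
Proof.
have pow2 (x : \bar R) : (0 <= x -> x ^+ 2 = x `^ 2%:R)%E.
  case: x => [r||] // r0; first by rewrite poweR_EFin powR_mulrn.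
  by rewrite poweRyr// expe2 mulyy.
rewrite /L2norm pow2 ?Lnorm_ge0// poweR_Lnorm//.
apply: eq_integral => x _ /=.
by rewrite powR_mulrn// real_normK// num_real.
Qed.

(** [H] stands for a lower bound of the geometric mean of [P] and [P']. Being linear in [H], [P] and
    [P'] up to the minimum, the inequality can be integrated directly, which replaces the
    Cauchy-Schwarz step of Le Cam's bound. *)
Lemma min_sqrt_bound (R : realFieldType) (P P' H : R) :
  0 <= P -> 0 <= P' -> 0 <= H -> H ^+ 2 <= P * P' ->
  H / 2 <= Num.min P P' + (P + P') / 16.
Proof.
move=> P0 P'0 H0 HP.
have key x y : 0 <= x -> 0 <= y -> H ^+ 2 <= x * y -> H / 2 <= x + (x + y) / 16.
  move=> x0 y0 Hxy; rewrite -(@ler_pXn2r _ 2)// ?nnegrE; try lra.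
  have -> : (x + (x + y) / 16) ^+ 2 =
      x * y / 4 + ((y - 15 * x) ^+ 2 + (8 * x) ^+ 2) / 256 by lra.
  have := sqr_ge0 (y - 15 * x); have := sqr_ge0 (8 * x); lra.
by case: (leP P P') => PP'; [exact: key|rewrite [P + P']addrC; apply: key => //; lra].
Qed.

Lemma mule_min_ge (R : realDomainType) (D D' : \bar R) (a P P' : R) :
  0 <= P -> 0 <= P' -> (0 <= D)%E -> (0 <= D')%E -> (a%:E <= D + D')%E ->
  ((a * Num.min P P')%:E <= D * P%:E + D' * P'%:E)%E.
Proof.
move=> P0 P'0 D0 D'0 aD; have m0 : 0 <= Num.min P P' by rewrite le_min P0.
apply: (@le_trans _ _ (D * (Num.min P P')%:E + D' * (Num.min P P')%:E)%E).
  by rewrite -ge0_muleDl// EFinM lee_wpmul2r.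
by apply: leeD; rewrite lee_wpmul2l// lee_fin ge_min lexx ?orbT.
Qed.

(* [2^-1 <= (\int h) ^+ n] bounds the Hellinger affinity of the two n-fold
   product laws from below. *)
Lemma two_point_lower_bound (R : realType) (d n : nat) (p p' : density R d)
    (h : Rd R d -> R) (D D' : n.-tuple (Rd R d) -> \bar R) (a : R) :
  measurable_fun setT D -> (forall t, 0 <= D t)%E ->
  measurable_fun setT D' -> (forall t, 0 <= D' t)%E ->
  measurable_fun setT h -> (forall x, 0 <= h x) ->
  (forall x, h x ^+ 2 <= p x * p' x) ->
  ((2^-1)%:E <= (\int[lebesgue_Rd R d]_x (h x)%:E) ^+ n)%E ->
  0 <= a -> (forall t, a%:E <= D t + D' t)%E ->
  ((a / 8)%:E <= \int[power_measure (law p) n]_t D t +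
                 \int[power_measure (law p') n]_t D' t)%E.
Proof.
move=> mD D0 mD' D'0 mh h0 hpp' hn a0 aD.
set nu := power_measure (lebesgue_Rd R d) n.
pose prd (g : Rd R d -> R) (t : n.-tuple (Rd R d)) := \prod_(i < n) g (tnth t i).
have mprd (g : Rd R d -> R) : measurable_fun setT g ->
    measurable_fun setT (fun t => (prd g t)%:E).
  exact: measurable_prod_tnth.
have prd_ge0 (g : Rd R d -> R) t : (forall x, 0 <= g x) -> 0 <= prd g t.
  by move=> g0; exact: prodr_ge0.
have prd_int (q : density R d) : (\int[nu]_t (prd q t)%:E = 1)%E.
  rewrite ge0_integral_power_prod; last exact: pdf_ge0; last exact: measurable_pdf.
  by rewrite integral_pdf -EFin_expe expr1n.
have [mp mp'] := (@measurable_pdf _ _ p, @measurable_pdf _ _ p').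
have [p0 p'0] := (pdf_ge0 p, pdf_ge0 p').
rewrite !ge0_integral_power_law//.
have mDP : measurable_fun setT (fun t => D t * (prd p t)%:E)%E.
  by apply: emeasurable_funM => //; exact: mprd.
have mDP' : measurable_fun setT (fun t => D' t * (prd p' t)%:E)%E.
  by apply: emeasurable_funM => //; exact: mprd.
have DP0 t : (0 <= D t * (prd p t)%:E)%E by rewrite mule_ge0// lee_fin prd_ge0.
have DP'0 t : (0 <= D' t * (prd p' t)%:E)%E by rewrite mule_ge0// lee_fin prd_ge0.
have a16 : 0 <= a / 16 by lra.
have pp0 t : 0 <= prd p t + prd p' t by rewrite addr_ge0// prd_ge0.
have mpp : measurable_fun setT (fun t => (prd p t)%:E + (prd p' t)%:E)%E.
  by apply: emeasurable_funD; exact: mprd.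
(* Each product density has mass 1, so the extra term integrates to [a / 8]. Removing it at the end
   leaves [a / 8] out of [a / 4]. *)
have : ((a / 4)%:E <= \int[nu]_t (D t * (prd p t)%:E) + \int[nu]_t (D' t * (prd p' t)%:E)
    + \int[nu]_t ((a / 16)%:E * ((prd p t)%:E + (prd p' t)%:E)))%E.
  rewrite -ge0_integralD// -ge0_integralD//; last 4 first.
  - by move=> t _; rewrite adde_ge0.
  - exact: emeasurable_funD.
  - by move=> t _; rewrite mule_ge0// lee_fin ?pp0.
  - by apply: emeasurable_funM => //.
  apply: (@le_trans _ _ (\int[nu]_t ((a / 2)%:E * (prd h t)%:E))%E).
    rewrite ge0_integralZl//; last 3 first.
    - exact: mprd.
    - by move=> t _; rewrite lee_fin prd_ge0.
    - by rewrite lee_fin divr_ge0.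
    rewrite ge0_integral_power_prod//.
    have -> : a / 4 = a / 2 * 2^-1 by lra.
    by rewrite EFinM lee_wpmul2l// lee_fin divr_ge0.
  apply: ge0_le_integral => //.
  - by move=> t _; rewrite mule_ge0// lee_fin ?divr_ge0// prd_ge0.
  - by apply: emeasurable_funM => //; exact: mprd.
  - by apply: emeasurable_funD; [exact: emeasurable_funD|exact: emeasurable_funM].
  move=> t _.
  have := mule_min_ge (prd_ge0 _ t p0) (prd_ge0 _ t p'0) (D0 t) (D'0 t) (aD t).
  move=> /(leeD2r ((a / 16)%:E * ((prd p t)%:E + (prd p' t)%:E))); apply: le_trans.
  rewrite -(EFinD (prd p t)) -!EFinM -EFinD lee_fin.
  have Hpp' : prd h t ^+ 2 <= prd p t * prd p' t.
    rewrite /prd -prodrXl -big_split/=; apply: ler_prod => i _.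
    by rewrite sqr_ge0 hpp'.
  have := min_sqrt_bound (prd_ge0 _ t p0) (prd_ge0 _ t p'0) (prd_ge0 _ t h0) Hpp'.
  by move=> /(ler_wpM2l a0); lra.
rewrite [X in (_ + X)%E]ge0_integralZl//; last by move=> t _; rewrite lee_fin.
rewrite ge0_integralD//; try by [move=> t _; rewrite lee_fin prd_ge0|exact: mprd].
rewrite !prd_int -EFinD -EFinM -leeBlDr// -EFinB.
by apply: le_trans; rewrite lee_fin; lra.
Qed.

(** * Assouad's reduction to pairs of neighbouring vertices *)

Definition flip (m : nat) (k : 'I_m) (s : {ffun 'I_m -> bool}) : {ffun 'I_m -> bool} :=
  [ffun i => s i (+) (i == k)].

Lemma flipK (m : nat) (k : 'I_m) : involutive (flip k).
Proof. by move=> s; apply/ffunP => i; rewrite !ffunE -addbA addbb addbF. Qed.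

Section assouad.
Context (R : realType) (d n m : nat).
Variables (p : {ffun 'I_m -> bool} -> density R d) (B : 'I_m -> set (Rd R d)).
Variables (h : 'I_m -> {ffun 'I_m -> bool} -> Rd R d -> R) (w delta : R).
Hypotheses (mB : forall k, measurable (B k))
  (B1 : forall x, \sum_(k < m) \1_(B k) x <= 1 :> R)
  (Bw : forall k, lebesgue_Rd R d (B k) = w%:E)
  (w0 : 0 <= w) (delta0 : 0 <= delta).
Hypothesis p_sep : forall k s x, B k x -> delta <= (p s x - p (flip k s) x) ^+ 2.
Hypotheses (mh : forall k s, measurable_fun setT (h k s))
  (h0 : forall k s x, 0 <= h k s x)
  (hpp : forall k s x, h k s x ^+ 2 <= p s x * p (flip k s) x)
  (hn : forall k s, ((2^-1)%:E <= (\int[lebesgue_Rd R d]_x (h k s x)%:E) ^+ n)%E).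
Variable T : n.-tuple (Rd R d) -> Rd R d -> R.
Hypothesis mT : estimator R d n T.

Let loss k s (t : n.-tuple (Rd R d)) (y : Rd R d) : R :=
  (T t y - p s y) ^+ 2 * \1_(B k) y.

Let loss_ge0 k s t y : 0 <= loss k s t y.
Proof. by rewrite mulr_ge0// sqr_ge0. Qed.

Let measurable_loss k s : measurable_fun setT
  (fun z : n.-tuple (Rd R d) * Rd R d => (loss k s z.1 z.2)%:E).
Proof.
apply/measurable_EFinP; apply: measurable_funM.
  apply: measurable_funX; apply: measurable_funB; first exact: mT.
  exact: (measurableT_comp (@measurable_pdf _ _ (p s)) measurable_snd).
exact: (measurableT_comp (measurable_indic (mB k)) measurable_snd).
Qed.

Let measurable_loss2 k s t : measurable_fun setT (fun y => (loss k s t y)%:E).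
Proof. exact: (measurableT_comp (measurable_loss k s) (pair1_measurable t)). Qed.

Let D k s t := (\int[lebesgue_Rd R d]_y (loss k s t y)%:E)%E.

Let D_ge0 k s t : (0 <= D k s t)%E.
Proof. by apply: integral_ge0 => y _; rewrite lee_fin. Qed.

Let measurable_D k s : measurable_fun setT (D k s).
Proof.
apply: (measurable_fun_fubini_tonelli_F _ (measurable_loss k s)).
by move=> z; rewrite lee_fin.
Qed.

Let r k s := (\int[power_measure (law (p s)) n]_t D k s t)%E.

Let measurable_sq_err s t : measurable_fun setT (fun y => ((T t y - p s y) ^+ 2)%:E).
Proof.
apply/measurable_EFinP; apply: measurable_funX; apply: measurable_funB; last first.
  exact: measurable_pdf.
exact: (measurableT_comp mT (pair1_measurable t)).
Qed.

(** By [B1] the losses localized to the cells [B k] add up to at most the whole squared error,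
    pointwise. Both integrations preserve this. *)
Let sum_r_le_risk s : (\sum_(k < m) r k s <= risk T (p s))%E.
Proof.
have sumD t : (\sum_(k < m) D k s t =
    \int[lebesgue_Rd R d]_y (\sum_(k < m) (loss k s t y)%:E))%E.
  by rewrite ge0_integral_sum// => k y _; rewrite lee_fin.
rewrite /r -ge0_integral_sum//.
apply: ge0_le_integral => //.
- by move=> t _; exact: sume_ge0.
- exact: emeasurable_sum.
- rewrite (_ : (fun t => _) = (fun t =>
      \int[lebesgue_Rd R d]_y ((T t y - p s y) ^+ 2)%:E)%E); last first.
    by apply/funext => t; rewrite L2norm_sqr.
  have mf : measurable_fun setT (fun z : n.-tuple (Rd R d) * Rd R d =>
      ((T z.1 z.2 - p s z.2) ^+ 2)%:E).
    apply/measurable_EFinP; apply: measurable_funX; apply: measurable_funB => //.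
    exact: (measurableT_comp (@measurable_pdf _ _ (p s)) measurable_snd).
  have sq0 (z : n.-tuple (Rd R d) * Rd R d) : (0 <= ((T z.1 z.2 - p s z.2) ^+ 2)%:E)%E.
    by rewrite lee_fin sqr_ge0.
  exact: (measurable_fun_fubini_tonelli_F _ mf sq0).
move=> t _; rewrite L2norm_sqr sumD; apply: ge0_le_integral => //.
- by move=> y _; apply: sume_ge0 => k _; rewrite lee_fin.
- exact: emeasurable_sum.
- exact: measurable_sq_err.
- move=> y _; rewrite sumEFin lee_fin -mulr_sumr.
  by rewrite ler_piMr// sqr_ge0.
Qed.

(** On [B k] the two squared errors add up to at least [delta / 2] whatever the estimate is, hence
    to [w * delta / 2] after integration over the cell. The two-point bound then costs a factor
    8. *)
Let two_point k s : ((w * delta / 16)%:E <= r k s + r k (flip k s))%E.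
Proof.
have -> : w * delta / 16 = (w * delta / 2) / 8 by lra.
apply: (@two_point_lower_bound _ _ _ _ _ (h k s)) => //.
  by rewrite !mulr_ge0.
move=> t; rewrite -ge0_integralD//; try by move=> y _; rewrite lee_fin.
apply: (@le_trans _ _ (\int[lebesgue_Rd R d]_y ((delta / 2)%:E * (\1_(B k) y)%:E))%E).
  rewrite ge0_integralZl//.
  - rewrite integral_indic// setIT -[X in (_ <= _ * X)%E]/(lebesgue_Rd R d (B k)) Bw.
    by rewrite -EFinM lee_fin; lra.
  - by apply/measurable_EFinP; exact: measurable_indic.
  - by rewrite lee_fin divr_ge0.
apply: ge0_le_integral => //.
- by move=> y _; rewrite -EFinM lee_fin !mulr_ge0.
- by apply: emeasurable_funM => //; apply/measurable_EFinP; exact: measurable_indic.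
- exact: emeasurable_funD.
- move=> y _; rewrite -EFinM -EFinD lee_fin -mulrDl indicE.
  have [yB|yB] := boolP (y \in B k); last by rewrite !mulr0.
  rewrite !mulr1; have := p_sep s (set_mem yB).
  (* For the two errors [u] and [v], [u ^+ 2 + v ^+ 2] is half of [(u - v) ^+ 2 + (u + v) ^+ 2], and
     [u - v] does not involve [T]. *)
  have := sqr_ge0 ((T t y - p s y) + (T t y - p (flip k s) y)).
  by rewrite !expr2; lra.
Qed.

(** The supremum dominates the average over all vertices [s], and for each [k] the vertices are
    paired by [flip k]. *)
Lemma assouad (S : \bar R) : (forall s, risk T (p s) <= S)%E ->
  ((m%:R * (w * delta) / 32)%:E <= S)%E.
Proof.
case: S => [S| |] riskS; last 2 first.
- by rewrite leey.
- have : (0 <= risk T (p [ffun=> false]))%E.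
    by apply: integral_ge0 => t _; rewrite expe_ge0// Lnorm_ge0.
  by move=> /le_trans/(_ (riskS _)).
set N := #|{: {ffun 'I_m -> bool}}|.
have N0 : 0 < N%:R :> R by rewrite ltr0n; apply/card_gt0P; exists [ffun=> false].
have sumC (c : R) (I : finType) : (\sum_(s : I) c%:E = (#|I|%:R * c)%:E)%E.
  by rewrite sumEFin sumr_const mulr_natl.
have SN : (\sum_(s : {ffun 'I_m -> bool}) \sum_(k < m) r k s <= (N%:R * S)%:E)%E.
  by rewrite -sumC; apply: lee_sum => s _; exact: le_trans (sum_r_le_risk s) _.
(* The sum is taken twice so that one copy can be reindexed by the involution [flip k]; this
   doubling turns 16 into 32. *)
suff : ((N%:R * (m%:R * (w * delta / 16)))%:E <= (N%:R * S)%:E + (N%:R * S)%:E)%E.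
  by rewrite -EFinD !lee_fin -mulrDr ler_pM2l//; lra.
apply: le_trans (leeD SN SN).
rewrite exchange_big /= -big_split /=.
rewrite mulrCA -{1}(card_ord m) -sumC; apply: lee_sum => k _.
rewrite [X in (_ + X)%E](reindex_inj (inv_inj (@flipK m k)))/= -big_split/=.
by rewrite -sumC; exact: lee_sum.
Qed.

End assouad.

(** * Disjoint cells and step functions on them *)

Lemma disjoint_cells (R : realType) (d : nat) (I : finType) (w : R) : (0 < d)%N -> 0 < w ->
  exists H : I -> set (Rd R d), [/\ forall i, measurable (H i),
    forall i, lebesgue_Rd R d (H i) = w%:E &
    forall i j x, H i x -> H j x -> i = j].
Proof.
case: d => // d _ w0.
pose a (i : I) : R := (enum_rank i)%:R.
(* The cells are boxes lined up along the first axis: the rank of [i] selects an interval of length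
   [w] there, and every other side is the unit interval. *)
pose A i (j : 'I_d.+1) : set R :=
  if j == ord0 then `[a i * w, (a i + 1) * w[%classic else `[0, 1[%classic.
have mA i j : measurable (A i j) by rewrite /A; case: ifP => _; exact: measurable_itv.
exists (fun i => [set x | forall j, A i j (tnth x j)]); split.
- by move=> i; exact: (measurable_box (mA i)).
- move=> i; transitivity (\prod_(j < d.+1) lebesgue_measure (A i j))%E.
    exact: (power_measure_box (@lebesgue_measure R) (mA i)).
  rewrite big_ord_recl big1 => [|j _].
    rewrite mule1 /A eqxx /= lebesgue_measure_itv/= lte_fin ltr_pM2r// ltrDl ltr01.
    by rewrite -EFinB; congr EFin; ring.
  by rewrite /A/= lebesgue_measure_itv/= lte_fin ltr01 sube0.
- move=> i j x Hi Hj; apply: enum_rank_inj; apply/val_inj => /=.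
  have := Hi ord0; have := Hj ord0; rewrite /A eqxx /= !in_itv/=.
  move=> /andP[j1 j2] /andP[i1 i2].
  have := le_lt_trans i1 j2; have := le_lt_trans j1 i2.
  (* A common point forces each rank to be less than the other plus one, so the two ranks are
     equal. *)
  rewrite !ltr_pM2r// /a !natr1 !ltr_nat !ltnS => ij ji.
  by apply/eqP; rewrite eqn_leq ij ji.
Qed.

Section step_functions.
Context (R : realType) (d : nat) (I : finType).
Variables (H : I -> set (Rd R d)) (w : R).
Hypotheses (mH : forall i, measurable (H i)).
Hypotheses (Hw : forall i, lebesgue_Rd R d (H i) = w%:E).
Hypotheses (disjH : forall i j x, H i x -> H j x -> i = j).

Definition step (c : I -> R) (x : Rd R d) : R := \sum_i c i * \1_(H i) x.

(** The cell is chosen before [c], so a single case analysis evaluates several step functions at the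
    same point. *)
Lemma step_values x :
  (exists2 i, H i x & forall c, step c x = c i) \/ (forall c, step c x = 0).
Proof.
have [[i Hix]|nH] := pselect (exists i, H i x); [left|right].
  exists i => // c; rewrite /step (bigD1 i)//= indicE mem_set// mulr1 big1 ?addr0//.
  move=> j ji; rewrite indicE memNset ?mulr0// => /(disjH Hix) ij.
  by rewrite ij eqxx in ji.
move=> c; rewrite /step big1// => i _; rewrite indicE memNset ?mulr0// => Hix.
by apply: nH; exists i.
Qed.

Lemma stepE c i x : H i x -> step c x = c i.
Proof.
move=> Hix; have [[j Hjx ->]|s0] := step_values x; first by rewrite (disjH Hix Hjx).
have := s0 (fun=> 1); rewrite /step (bigD1 i)//= indicE mem_set// mulr1 => /eqP.
rewrite paddr_eq0 ?oner_eq0//; first exact: sumr_ge0.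
Qed.

Lemma step_ge0 c x : (forall i, 0 <= c i) -> 0 <= step c x.
Proof. by move=> c0; apply: sumr_ge0 => i _; rewrite mulr_ge0. Qed.

Lemma measurable_step c : measurable_fun setT (step c).
Proof.
by apply: measurable_sum => i; apply: measurable_funM.
Qed.

Lemma integral_step c : (forall i, 0 <= c i) ->
  (\int[lebesgue_Rd R d]_x (step c x)%:E = (w * \sum_i c i)%:E)%E.
Proof.
move=> c0; under eq_integral do rewrite /step -sumEFin.
rewrite ge0_integral_sum//; last 2 first.
- by move=> i; apply/measurable_EFinP; apply: measurable_funM.
- by move=> i x _; rewrite lee_fin mulr_ge0.
rewrite mulr_sumr -sumEFin; apply: eq_bigr => i _.
under eq_integral do rewrite EFinM.
rewrite ge0_integralZl ?lee_fin//; last first.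
  by apply/measurable_EFinP; exact: measurable_indic.
rewrite integral_indic// setIT -[X in (_ * X)%E]/(lebesgue_Rd R d (H i)) Hw.
by rewrite -EFinM mulrC.
Qed.

End step_functions.

(** * Densities constant on cells, and their exact representation by mixtures *)

Lemma sum_pair_bool (R : nmodType) (m : nat) (F : 'I_m * bool -> R) :
  \sum_i F i = \sum_(k < m) (F (k, true) + F (k, false)).
Proof.
rewrite (eq_bigr (fun i => F (i.1, i.2))) => [|[]//].
rewrite -(pair_bigA _ (fun k b => F (k, b)))/=.
by apply: eq_bigr => k _; rewrite big_bool.
Qed.

Section step_densities.
Context (R : realType) (d m : nat).
Variables (L : R) (H : 'I_m * bool -> set (Rd R d)).
Hypotheses (L0 : 0 < L) (m0 : (0 < m)%N).
Hypotheses (mH : forall i, measurable (H i)).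
Hypotheses (Hw : forall i, lebesgue_Rd R d (H i) = ((L * m%:R)^-1)%:E).
Hypotheses (disjH : forall i j x, H i x -> H j x -> i = j).

Let Lm0 : L * m%:R != 0.
Proof. by rewrite mulf_neq0 ?gt_eqF// ltr0n. Qed.

Definition coef (a : 'I_m -> R) (i : 'I_m * bool) : R :=
  L / 2 * (1 + (if i.2 then a i.1 else - a i.1)).

Lemma coef_itv a i : (forall k, `|a k| <= 1) -> 0 <= coef a i <= L.
Proof.
move=> /(_ i.1); rewrite ler_norml /coef; case: i => k b /= /andP[a1 a2].
set y := 1 + _; have [y0 y2] : 0 <= y /\ y <= 2 by rewrite {}/y; case: b; lra.
by rewrite mulr_ge0 ?divr_ge0 ?(ltW L0)//= -ler_pdivlMl ?divr_gt0// invf_div mulfVK ?gt_eqF.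
Qed.

(** The perturbations cancel within each pair of cells, so the total does not depend on [a]; the
    cell volume is its inverse. *)
Lemma sum_coef a : \sum_i coef a i = L * m%:R.
Proof.
rewrite sum_pair_bool (eq_bigr (fun=> L)) ?sumr_const ?card_ord ?mulr_natr// => k _.
by rewrite /coef/=; lra.
Qed.

Lemma integral_step_coef a : (forall k, `|a k| <= 1) ->
  (\int[lebesgue_Rd R d]_x (step H (coef a) x)%:E = 1)%E.
Proof.
move=> a1; rewrite (integral_step mH Hw); last first.
  by move=> i; have /andP[] := coef_itv i a1.
by rewrite sum_coef mulVf.
Qed.

Lemma step_coef_ge0 a x : (forall k, `|a k| <= 1) -> 0 <= step H (coef a) x.
Proof. by move=> a1; apply: step_ge0 => i; have /andP[] := coef_itv i a1. Qed.

Definition step_density a (a1 : forall k, `|a k| <= 1) : density R d :=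
  Density (measurable_step mH (coef a)) (fun x => step_coef_ge0 x a1)
    (integral_step_coef a1).

Lemma step_density_le a (a1 : forall k, `|a k| <= 1) x : step_density a1 x <= L.
Proof.
rewrite /=; have [[i _ ->]|->] := step_values disjH x; last exact: ltW.
by have /andP[] := coef_itv i a1.
Qed.

Lemma step_density_bounded a (a1 : forall k, `|a k| <= 1) :
  bounded_densities d L (step_density a1).
Proof.
(* The second case is the default value 0 of the norm on a space of measure zero. *)
rewrite /bounded_densities /Linftynorm /= unlock; case: ifPn => _; last by rewrite lee_fin ltW.
apply/ess_supP; apply/nearW => x /=.
by rewrite lee_fin ger0_norm ?step_density_le// step_coef_ge0.
Qed.

(** A density [f] bounded by [L] satisfies [f ^+ 2 <= L * f] pointwise, so its squared norm is at
    most [L]. *)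
Lemma L2norm_step_density a (a1 : forall k, `|a k| <= 1) :
  (L2norm (step_density a1) < +oo)%E.
Proof.
have : (L2norm (step_density a1) ^+ 2 < +oo)%E.
  rewrite L2norm_sqr; apply: (@le_lt_trans _ _ L%:E); last exact: ltry.
  rewrite -[leRHS]mule1 -(integral_pdf (step_density a1)) -ge0_integralZl//.
  - have mp := @measurable_pdf _ _ (step_density a1).
    apply: ge0_le_integral => //.
    + by move=> x _; rewrite lee_fin sqr_ge0.
    + by apply/measurable_EFinP; exact: measurable_funX.
    + by apply: emeasurable_funM => //; apply/measurable_EFinP.
    + move=> x _; rewrite -EFinM lee_fin expr2.
      by rewrite ler_wpM2r ?pdf_ge0// step_density_le.
  - by apply/measurable_EFinP; exact: measurable_pdf.
  - by move=> x _; rewrite lee_fin pdf_ge0.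
  - by rewrite lee_fin ltW.
by rewrite !ltey; apply: contra => /eqP ->; rewrite expe2 mulyy.
Qed.

(** One formula covers the whole basis: [j = ord0] gives the zero vector, and [j = lift ord0 k]
    gives the [k]-th unit vector. *)
Lemma basis_coef_norm (j : 'I_m.+1) k : `|(j == lift ord0 k)%:R| <= 1 :> R.
Proof. by case: (j == _); rewrite ?normr1 ?normr0. Qed.

Definition step_basis (j : 'I_m.+1) : density R d := step_density (basis_coef_norm j).

(** The density is affine in [a]: the unit vectors get the weights [a k], and the zero vector gets
    the remainder that makes the weights sum to 1. Weights may be negative. *)
Lemma step_density_mixture a (a1 : forall k, `|a k| <= 1) :
  exists l : 'rV[R]_m.+1, mixture step_basis l =1 step_density a1.
Proof.
exists (\row_j (if unlift ord0 j is Some k then a k else 1 - \sum_k a k)) => x.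
rewrite /mixture big_ord_recl mxE unlift_none.
rewrite [X in _ + X](eq_bigr (fun k => a k * step_basis (lift ord0 k) x)); last first.
  by move=> k _; rewrite mxE liftK.
rewrite /=; have [[[k b] _ sE]|s0] := step_values disjH x; last first.
  by rewrite !s0 mulr0 add0r big1// => j _; rewrite s0 mulr0.
rewrite [X in _ + X](eq_bigr (fun j =>
  a j * coef (fun k' => (lift ord0 j == lift ord0 k')%:R) (k, b))); last first.
  by move=> j _; rewrite sE.
rewrite !sE /coef/=.
set e : R := if b then 1 else -1.
have eM (y : R) : (if b then y else - y) = e * y.
  by rewrite /e; case: b {sE e}; rewrite ?mul1r ?mulN1r.
rewrite !eM mulr0 addr0 mulr1.
(* The weighted unit vectors contribute [a j] for each [j], except that [k] contributes
   [(1 + e) * a k]. *)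
transitivity ((1 - \sum_k a k) * (L / 2) + (L / 2) * (\sum_k a k + e * a k)); last by ring.
congr (_ + _); rewrite (bigD1 k)//= eM eqxx.
rewrite (eq_bigr (fun j => L / 2 * a j)) => [|j jk].
  by rewrite -mulr_sumr [in RHS](bigD1 k)//=; ring.
by rewrite eM (inj_eq lift_inj) (negbTE jk)/=; ring.
Qed.

Lemma oracle_risk_step_basis a (a1 : forall k, `|a k| <= 1) :
  (oracle_risk step_basis (step_density a1) <= 0)%E.
Proof.
have [l lE] := step_density_mixture a1.
apply: ereal_inf_lbound; exists l => //.
rewrite L2norm_sqr integral0_eq// => x _.
by rewrite /= lE subrr expr0n.
Qed.

End step_densities.

(** * The hypercube of densities and its affinity *)

Lemma bernoulli_ineq (R : realDomainType) (x : R) (n : nat) :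
  0 <= x <= 1 -> 1 - n%:R * x <= (1 - x) ^+ n.
Proof.
move=> /andP[x0 x1]; elim: n => [|n IHn]; first by rewrite mul0r subr0.
rewrite exprS; apply: (@le_trans _ _ ((1 - x) * (1 - n%:R * x))); last first.
  by rewrite ler_wpM2l// subr_ge0.
rewrite -natr1; have := mulr_ge0 (ler0n R n) (sqr_ge0 x); rewrite expr2; lra.
Qed.

Section hypercube.
Context (R : realType) (d m n : nat).
Variables (L eps : R) (H : 'I_m * bool -> set (Rd R d)).
Hypotheses (L0 : 0 < L) (m0 : (0 < m)%N).
Hypotheses (eps0 : 0 <= eps) (eps1 : eps <= 1).
Hypothesis eps_n : eps ^+ 2 * n%:R * 2 <= m%:R.
Hypotheses (mH : forall i, measurable (H i)).
Hypotheses (Hw : forall i, lebesgue_Rd R d (H i) = ((L * m%:R)^-1)%:E).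
Hypotheses (disjH : forall i j x, H i x -> H j x -> i = j).

Definition amplitude (s : {ffun 'I_m -> bool}) (k : 'I_m) : R :=
  if s k then eps else - eps.

Lemma amplitude_norm s k : `|amplitude s k| <= 1.
Proof. by rewrite /amplitude; case: (s k); rewrite ?normrN ger0_norm. Qed.

Let p s := step_density L0 m0 mH Hw (amplitude_norm s).

(* Equals p s off the k-th pair of cells, and bounds sqrt (p s * p (flip k s))
   from below on that pair. *)
Let affinity_coef (k : 'I_m) s (i : 'I_m * bool) : R :=
  if i.1 == k then L / 2 * (1 - eps ^+ 2) else coef L (amplitude s) i.

Let eps2_le1 : eps ^+ 2 <= 1.
Proof. by rewrite expr_le1. Qed.

Let coef_ge0 s i : 0 <= coef L (amplitude s) i.
Proof. by have /andP[] := coef_itv L0 i (amplitude_norm s). Qed.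

Let affinity_coef_ge0 k s i : 0 <= affinity_coef k s i.
Proof.
rewrite /affinity_coef; case: ifP => // _.
by rewrite mulr_ge0 ?divr_ge0 ?subr_ge0// ltW.
Qed.

(** Off pair [k] the flip changes nothing and equality holds. On that pair the product is
    [(L / 2) ^+ 2 * (1 - eps ^+ 2)], and [1 - eps ^+ 2] dominates its own square. *)
Let affinity_coef_sqr k s i :
  affinity_coef k s i ^+ 2 <= coef L (amplitude s) i * coef L (amplitude (flip k s)) i.
Proof.
rewrite /affinity_coef; case: i => j b; rewrite /coef/= /amplitude ffunE.
case: eqP => [->|_]; last by rewrite addbF.
have e2 := eps2_le1; have e0 := sqr_ge0 eps.
have -> : (L / 2 * (1 - eps ^+ 2)) ^+ 2 =
    (L / 2) ^+ 2 * (1 - eps ^+ 2) * (1 - eps ^+ 2) by ring.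
apply: (@le_trans _ _ ((L / 2) ^+ 2 * (1 - eps ^+ 2))).
  by apply: ler_piMr; [rewrite mulr_ge0 ?sqr_ge0 ?subr_ge0|rewrite gerBl].
by rewrite addbT; case: b; case: (s k) => /=; lra.
Qed.

(** Only pair [k] loses mass: its total falls from [L] to [L * (1 - eps ^+ 2)]. *)
Let sum_affinity_coef k s :
  (L * m%:R)^-1 * \sum_i affinity_coef k s i = 1 - eps ^+ 2 / m%:R.
Proof.
have mR : m%:R != 0 :> R by rewrite pnatr_eq0 -lt0n.
rewrite sum_pair_bool (eq_bigr (fun j => L - (j == k)%:R * (L * eps ^+ 2))).
  rewrite sumrB sumr_const card_ord -mulr_suml (bigD1 k)//= eqxx big1 ?addr0 ?mul1r.
    by rewrite -mulr_natr; field; rewrite mR gt_eqF.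
  by move=> j /negbTE ->.
move=> j _; rewrite /affinity_coef /coef/=.
by case: eqP => _ /=; lra.
Qed.

Lemma hypercube_lower_bound (T : n.-tuple (Rd R d) -> Rd R d -> R) (S : \bar R) :
  estimator R d n T -> (forall s, risk T (p s) <= S)%E ->
  ((L * eps ^+ 2 / 32)%:E <= S)%E.
Proof.
move=> mT riskS.
have mR : 0 < m%:R :> R by rewrite ltr0n.
have -> : L * eps ^+ 2 / 32 = m%:R * ((L * m%:R)^-1 * (L * eps) ^+ 2) / 32.
  by field; rewrite !gt_eqF.
(* Only the [true] half of each pair serves as [B k]. There a flip moves the density by [L * eps],
   so [delta] is [(L * eps) ^+ 2]. *)
apply: (@assouad R d n m p (fun k => H (k, true))
  (fun k s => step H (affinity_coef k s)) _ _ _ _ _ _ _ _ _ _ _ _ T mT S riskS).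
- by [].
- move=> x; have -> : \sum_(k < m) \1_(H (k, true)) x = step H (fun i => i.2%:R) x.
    by rewrite /step sum_pair_bool; apply: eq_bigr => k _; rewrite mul1r mul0r addr0.
  by have [[[k []] _ ->]|->] := step_values disjH x.
- by [].
- by rewrite invr_ge0 mulr_ge0// ltW.
- by rewrite sqr_ge0.
- move=> k s x Hx; rewrite /= !(stepE disjH _ Hx) /coef /amplitude /= ffunE eqxx addbT.
  by case: (s k) => /=; lra.
- by move=> k s; exact: measurable_step.
- by move=> k s x; exact: step_ge0.
- move=> k s x /=; have [[i _ sE]|s0] := step_values disjH x.
    by rewrite !sE affinity_coef_sqr.
  by rewrite !s0 expr0n mulr0.
- move=> k s; rewrite (integral_step mH Hw)// sum_affinity_coef -EFin_expe lee_fin.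
  (* Bernoulli's inequality with [x = eps ^+ 2 / m]: by [eps_n] the affinity after [n] observations
     stays at least 1/2. *)
  apply: le_trans (bernoulli_ineq _ _).
    have : n%:R * (eps ^+ 2 / m%:R) <= 2^-1.
      by rewrite mulrA ler_pdivrMr// mulrC; move: eps_n; lra.
    by lra.
  rewrite divr_ge0 ?sqr_ge0 ?(ltW mR)//= ler_pdivrMr// mul1r (le_trans eps2_le1)//.
  by rewrite ler1n.
Qed.

End hypercube.

(** * Choice of the amplitude and conclusion *)

Theorem theorem3p1 (R : realType) (c0 : R) (hc0 : 0 < c0) :
  exists2 c : R, 0 < c &
  forall (d : nat) (L : R) (M n : nat),
    (1 <= d)%N -> 0 < L -> (2 <= M)%N -> (1 <= n)%N -> M%:R <= c0 * n%:R ->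
  exists2 q : 'I_M -> density R d,
    (forall j, L2norm (q j) < +oo)%E &
    ((c * L * M%:R / n%:R)%:E <=
     ereal_inf [set ereal_sup [set risk T p - oracle_risk q p
                              | p in bounded_densities d L]
               | T in estimator R d n])%E.
Proof.
(* With [eps ^+ 2 = kappa * M / n], two bounds are required: [kappa * c0 <= 1] for [eps <= 1], and
   [kappa <= 1 / 4] for [eps_n]. This value meets both and depends on [c0] alone. *)
pose kappa : R := (4 * (1 + c0))^-1.
have k0 : 0 < kappa by rewrite invr_gt0; lra.
have k4 : kappa * (4 * (1 + c0)) = 1 by rewrite mulVf// gt_eqF//; lra.
exists (kappa / 32); first by rewrite divr_gt0.
(* [M] becomes [m.+1]: one density for the zero vector and [m] for the unit vectors, with [m]
   positive since [2 <= M]. *)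
move=> d L [//|m] n d0 L0 m0 n0 Mn.
have nR : 0 < n%:R :> R by rewrite ltr0n.
have mR : 1 <= m%:R :> R by rewrite ler1n.
have MR : m.+1%:R = m%:R + 1 :> R by rewrite natr1.
have Lm0 : 0 < (L * m%:R)^-1 by rewrite invr_gt0 mulr_gt0// ltr0n.
have [H [mH Hw disjH]] := @disjoint_cells R d ('I_m * bool)%type _ d0 Lm0.
pose e2 := kappa * m.+1%:R / n%:R.
have e20 : 0 <= e2 by rewrite divr_ge0 ?mulr_ge0 ?ltW.
have e2n : e2 * n%:R = kappa * m.+1%:R by rewrite divfK// gt_eqF.
pose eps := Num.sqrt e2.
have epsE : eps ^+ 2 = e2 by rewrite sqr_sqrtr.
have eps0 : 0 <= eps by exact: sqrtr_ge0.
have eps1 : eps <= 1.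
  rewrite -(@expr_le1 _ 2)// epsE ler_pdivrMr// mul1r.
  by apply: (le_trans (ler_wpM2l (ltW k0) Mn)); rewrite mulrA; nra.
(* As [m >= 1], [m + 1 <= 2 * m], so [2 * kappa * (m + 1) <= 4 * kappa * m <= m]. *)
have eps_n : eps ^+ 2 * n%:R * 2 <= m%:R by rewrite epsE e2n MR; nra.
exists (step_basis L0 m0 mH Hw).
  by move=> j; exact: L2norm_step_density.
apply: le_ereal_inf_tmp => _ [T mT <-].
have -> : kappa / 32 * L * m.+1%:R / n%:R = L * eps ^+ 2 / 32.
  by rewrite epsE /e2; ring.
apply: (@hypercube_lower_bound R d m n L eps H L0 m0 eps0 eps1 eps_n mH Hw disjH T _ mT) => s.
set a1 := amplitude_norm _ _ s.
apply: (@le_trans _ _ (risk T (step_density L0 m0 mH Hw a1) -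
    oracle_risk (step_basis L0 m0 mH Hw) (step_density L0 m0 mH Hw a1))%E).
  (* The oracle risk is at most 0, so subtracting it cannot lower the risk. *)
  by rewrite leeDl// oppe_ge0; exact: oracle_risk_step_basis.
apply: ereal_sup_ubound; exists (step_density L0 m0 mH Hw a1) => //.
exact: step_density_bounded.
Qed.
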